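(* Let $\mathsf E=\{\mathsf E_x\}_{x\in\mathcal X}$ be a non-trivial observable on $\mathcal H_S$. (a) If $\mathsf E$ is completely unsharp, then there exists an $\mathsf E$-instrument $\mathcal I$, implemented by a measurement scheme constrained by the third law, such that $\mathcal I$ does not disturb any observable $\mathsf F$ commuting with $\mathsf E$. In fact $\mathcal F(\mathcal I_{\mathcal X}^* )=\mathsf E'$. (b) If $\|\mathsf E_x\|=1$ for some $x\in\mathcal X$, then there exists an orthogonal projection $P$ on $\mathcal H_S$ with the following two properties. First, $P$ commutes with every $\mathsf E_y$. Second, for every $\mathsf E$-instrument $\mathcal I$ implemented by a measurement scheme constrained by the third law, $\mathcal I_{\mathcal X}^*(P)\neq P$. In particular, the binary observable $\{P,\mathbb 1-P\}$ commutes with $\mathsf E$ but is disturbed by every such instrument.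
   Context: All Hilbert spaces are finite-dimensional and complex, and $\mathcal L(\mathcal H)$ denotes the linear operators on $\mathcal H$. A state is a positive operator of unit trace; it is full-rank if it is positive definite. A channel $\Phi:\mathcal L(\mathcal H)\to\mathcal L(\mathcal K)$ is a completely positive trace-preserving linear map. Its dual $\Phi^*:\mathcal L(\mathcal K)\to\mathcal L(\mathcal H)$ is defined by $\mathrm{tr}[A\Phi(B)]=\mathrm{tr}[\Phi^*(A)B]$. A channel is constrained by the third law if it maps every full-rank state on its input space to a full-rank state on its output space. Let $\mathcal H_S$ satisfy $2\le\dim\mathcal H_S<\infty$. An observable is a finite family $\mathsf E=\{\mathsf E_x\}_{x\in\mathcal X}$ of nonzero operators with $0\le\mathsf E_x\le\mathbb 1$ and $\sum_x\mathsf E_x=\mathbb 1$. It is non-trivial if some $\mathsf E_x$ is not a multiple of $\mathbb 1$. It is completely unsharp if, for every $x$, the spectrum of $\mathsf E_x$ contains neither $0$ nor $1$. An $\mathsf E$-instrument is a family $\mathcal I=\{\mathcal I_x\}_{x\in\mathcal X}$ of completely positive maps on $\mathcal L(\mathcal H_S)$ such that $\mathrm{tr}[\mathcal I_x(\rho)]=\mathrm{tr}[\mathsf E_x\rho]$ for all $x$ and all states $\rho$. Then $\mathcal I_{\mathcal X}:=\sum_x\mathcal I_x$ is a channel. A measurement scheme is a tuple $\mathcal M=(\mathcal H_A,\xi,\mathcal E,\mathsf Z)$ consisting of: - a finite-dimensional Hilbert space $\mathcal H_A$; - a state $\xi$ on $\mathcal H_A$; - a channel $\mathcal E$ acting on $\mathcal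 L(\mathcal H_S\otimes\mathcal H_A)$; - a family $\mathsf Z=\{\mathsf Z_x\}_{x\in\mathcal X}$ of positive operators on $\mathcal H_A$ summing to $\mathbb 1$. It implements the instrument $\mathcal I_x(\rho)=\mathrm{tr}_A[(\mathbb 1\otimes\mathsf Z_x)\mathcal E(\rho\otimes\xi)]$, which is an $\mathsf E$-instrument for $\mathsf E_x=\mathcal I_x^*(\mathbb 1)$. The scheme is constrained by the third law if $\xi$ is full-rank and $\mathcal E$ is constrained by the third law. An $\mathsf E$-instrument $\mathcal I$ does not disturb an observable $\mathsf F=\{\mathsf F_y\}$ if $\mathrm{tr}[\mathsf F_y\mathcal I_{\mathcal X}(\rho)]=\mathrm{tr}[\mathsf F_y\rho]$ for all $y$ and all states $\rho$; equivalently, $\mathcal I_{\mathcal X}^*(\mathsf F_y)=\mathsf F_y$. The fixed-point set is $\mathcal F(\mathcal I_{\mathcal X}^* )=\{A:\mathcal I_{\mathcal X}^*(A)=A\}$. The commutant is $\mathsf E'=\{A\in\mathcal L(\mathcal H_S):[A,\mathsf E_x]=0\ \forall x\}$. *)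

(* Defs.v *)
(* Quantum operators are square matrices over an arbitrary
   numClosedFieldType C (e.g. the complex numbers); H_S = C^n, H_A = C^m,
   H_S (x) H_A = C^(n*m) with the Kronecker index convention of mxtens. *)
From HB Require Import structures.
From mathcomp Require Import all_boot all_order all_algebra.
From mathcomp Require Import mxtens.
Set Implicit Arguments.
Unset Strict Implicit.
Unset Printing Implicit Defensive.
Import Order.TTheory GRing.Theory Num.Theory.
Local Open Scope ring_scope.

Section QDefs.
Variable C : numClosedFieldType.

Definition adjmx {p q} (A : 'M[C]_(p, q)) : 'M[C]_(q, p) := (map_mx Num.conj A)^T.

Definition psd {n} (A : 'M[C]_n) : Prop :=
  forall v : 'cV[C]_n, 0 <= (adjmx v *m A *m v) 0 0.

Definition pd {n} (A : 'M[C]_n) : Prop :=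
  forall v : 'cV[C]_n, v != 0 -> 0 < (adjmx v *m A *m v) 0 0.

Definition is_state {n} (rho : 'M[C]_n) : Prop := psd rho /\ \tr rho = 1.
Definition full_rank_state {n} (rho : 'M[C]_n) : Prop := pd rho /\ \tr rho = 1.

Definition linmap {n k} (Phi : 'M[C]_n -> 'M[C]_k) : Prop :=
  forall (a : C) (A B : 'M[C]_n), Phi (a *: A + B) = a *: Phi A + Phi B.

(* Phi (x) id_r acting on L(C^n (x) C^r) *)
Definition ampl {n k} (r : nat) (Phi : 'M[C]_n -> 'M[C]_k)
  (X : 'M[C]_(n * r)) : 'M[C]_(k * r) :=
  \matrix_(p, q)
    (Phi (\matrix_(i, j) X (mxtens_index (i, (mxtens_unindex p).2))
                           (mxtens_index (j, (mxtens_unindex q).2))))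
      (mxtens_unindex p).1 (mxtens_unindex q).1.

Definition CP {n k} (Phi : 'M[C]_n -> 'M[C]_k) : Prop :=
  linmap Phi /\ forall (r : nat) (X : 'M[C]_(n * r)), psd X -> psd (ampl Phi X).

Definition TP {n k} (Phi : 'M[C]_n -> 'M[C]_k) : Prop :=
  forall A, \tr (Phi A) = \tr A.

Definition channel {n k} (Phi : 'M[C]_n -> 'M[C]_k) : Prop := CP Phi /\ TP Phi.

(* the dual map, characterised by tr[A Phi(B)] = tr[Phi^*(A) B] *)
Definition dual {n k} (Phi : 'M[C]_n -> 'M[C]_k) (A : 'M[C]_k) : 'M[C]_n :=
  \matrix_(i, j) \tr (A *m Phi (delta_mx j i)).

Definition third_law {n k} (Phi : 'M[C]_n -> 'M[C]_k) : Prop :=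
  forall rho, full_rank_state rho -> full_rank_state (Phi rho).

Definition observable {n} {X : finType} (E : X -> 'M[C]_n) : Prop :=
  (forall x, E x != 0) /\ (forall x, psd (E x)) /\ (forall x, psd (1%:M - E x))
  /\ \sum_x E x = 1%:M.

Definition nontrivial {n} {X : finType} (E : X -> 'M[C]_n) : Prop :=
  exists x, ~ exists c : C, E x = c%:M.

Definition completely_unsharp {n} {X : finType} (E : X -> 'M[C]_n) : Prop :=
  forall x, ~~ eigenvalue (E x) 0 /\ ~~ eigenvalue (E x) 1.

(* operator norm ||A|| = 1: ||A v|| <= ||v|| for all v, with equality at some
   nonzero v (the sup of the operator norm is attained in finite dimension) *)
Definition opnorm_eq1 {n} (A : 'M[C]_n) : Prop :=
  (forall v : 'cV[C]_n,
      (adjmx (A *m v) *m (A *m v)) 0 0 <= (adjmx v *m v) 0 0) /\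
  (exists v : 'cV[C]_n, v != 0 /\
      (adjmx (A *m v) *m (A *m v)) 0 0 = (adjmx v *m v) 0 0).

Definition orth_proj {n} (P : 'M[C]_n) : Prop := P *m P = P /\ adjmx P = P.

Definition instrument {n} {X : finType} (E : X -> 'M[C]_n)
  (I : X -> 'M[C]_n -> 'M[C]_n) : Prop :=
  (forall x, CP (I x)) /\
  (forall x rho, is_state rho -> \tr (I x rho) = \tr (E x *m rho)).

Definition instr_total {n} {X : finType} (I : X -> 'M[C]_n -> 'M[C]_n)
  (rho : 'M[C]_n) : 'M[C]_n := \sum_x I x rho.

Definition ptrace2 {n m} (M : 'M[C]_(n * m)) : 'M[C]_n :=
  \matrix_(i, j) \sum_(a < m) M (mxtens_index (i, a)) (mxtens_index (j, a)).

Definition meas_scheme {n m} {X : finType} (xi : 'M[C]_m)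
  (Ecal : 'M[C]_(n * m) -> 'M[C]_(n * m)) (Z : X -> 'M[C]_m) : Prop :=
  is_state xi /\ channel Ecal /\ (forall x, psd (Z x)) /\ \sum_x Z x = 1%:M.

Definition implements {n m} {X : finType} (xi : 'M[C]_m)
  (Ecal : 'M[C]_(n * m) -> 'M[C]_(n * m)) (Z : X -> 'M[C]_m)
  (I : X -> 'M[C]_n -> 'M[C]_n) : Prop :=
  forall x (rho : 'M[C]_n),
    I x rho = ptrace2 (tensmx (1%:M : 'M[C]_n) (Z x) *m Ecal (tensmx rho xi)).

Definition third_law_implementable {n} {X : finType}
  (I : X -> 'M[C]_n -> 'M[C]_n) : Prop :=
  exists (m : nat) (xi : 'M[C]_m) (Ecal : 'M[C]_(n * m) -> 'M[C]_(n * m))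
         (Z : X -> 'M[C]_m),
    meas_scheme xi Ecal Z /\ pd xi /\ third_law Ecal /\ implements xi Ecal Z I.

Definition does_not_disturb {n} {X Y : finType} (I : X -> 'M[C]_n -> 'M[C]_n)
  (F : Y -> 'M[C]_n) : Prop :=
  forall y rho, is_state rho ->
    \tr (F y *m instr_total I rho) = \tr (F y *m rho).

Definition commutes_with {n} {X : finType} (E : X -> 'M[C]_n) (A : 'M[C]_n) : Prop :=
  forall x, A *m E x = E x *m A.

End QDefs.

(* Main.v *)
(** (a) The Lueders instrument [rho |-> S_x rho S_x] with [S_x = sqrt E_x] has
    fixed-point set the commutant of [E], and it is realised with a pointer space
    having one basis vector per outcome, [xi] maximally mixed, and an interaction
    that discards the pointer and writes the outcome [x] in it:
    [T |-> \sum_x S_x (tr_A T) S_x (x) |x><x|].  This interaction maps full-rank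
    states to full-rank states as soon as all the [S_x] are invertible.

    (b) Let [P] project on a unit vector [v] with [E_x v = v]; then [E_y v = 0] for
    [y != x], so [P] commutes with [E].  If [P] is fixed by the dual of the total
    channel, then [P (x) (1 - Z_x)] has trace zero against the image of [P (x) xi]
    (the outcome [x] is certain on [P]) and against that of [(1 - P) (x) xi] (the
    output stays orthogonal to [P]), hence against the image of [1 (x) xi].  The
    latter is positive definite by the third law, so [Z_x = 1], whence [E_x = 1] and
    [E] is trivial. *)
Require Import Defs.
From HB Require Import structures.
From mathcomp Require Import all_boot all_order all_algebra.
From mathcomp Require Import mxtens ring.
Set Implicit Arguments.
Unset Strict Implicit.
Unset Printing Implicit Defensive.
Import Order.TTheory GRing.Theory Num.Theory.
Local Open Scope ring_scope.

(** * Positive matrices *)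
Section Operators.
Variable C : numClosedFieldType.

(** * Algebra of the adjoint *)

Lemma adjmxE p q (A : 'M[C]_(p, q)) i j : adjmx A i j = (A j i)^*.
Proof. by rewrite !mxE. Qed.

Lemma adjmxK p q (A : 'M[C]_(p, q)) : adjmx (adjmx A) = A.
Proof. by apply/matrixP=> i j; rewrite !adjmxE conjCK. Qed.

Lemma adjmxM p q r (A : 'M[C]_(p, q)) (B : 'M[C]_(q, r)) :
  adjmx (A *m B) = adjmx B *m adjmx A.
Proof. by rewrite /adjmx map_mxM trmx_mul. Qed.

Lemma adjmxD p q (A B : 'M[C]_(p, q)) : adjmx (A + B) = adjmx A + adjmx B.
Proof. by rewrite /adjmx map_mxD linearD. Qed.

Lemma adjmxZ p q a (A : 'M[C]_(p, q)) : adjmx (a *: A) = a^* *: adjmx A.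
Proof. by rewrite /adjmx map_mxZ linearZ. Qed.

Lemma adjmx1 n : adjmx (1%:M : 'M[C]_n) = 1%:M.
Proof. by rewrite /adjmx map_mx1 trmx1. Qed.

Lemma adjmx_tens p q r s (A : 'M[C]_(p, q)) (B : 'M[C]_(r, s)) :
  adjmx (tensmx A B) = tensmx (adjmx A) (adjmx B).
Proof. by rewrite /adjmx map_mxT trmx_tens. Qed.

Lemma adjmx_delta p q (i : 'I_p) (j : 'I_q) :
  adjmx (delta_mx i j : 'M[C]_(p, q)) = delta_mx j i.
Proof. by rewrite /adjmx map_delta_mx trmx_delta. Qed.

Lemma mxtrace_mul_delta n (A : 'M[C]_n) i j :
  \tr (A *m delta_mx j i) = A i j.
Proof.
rewrite /mxtrace (bigD1 i) //= big1 ?addr0 => [|k ki]; rewrite !mxE.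
  by rewrite (bigD1 j) //= big1 ?addr0 => [|l /negPf lj];
    rewrite mxE ?lj ?mulr0 // !eqxx mulr1.
by rewrite big1 // => l _; rewrite mxE (negPf ki) andbF mulr0.
Qed.

Lemma diag_adjmx_mul p q (T : 'M[C]_p) (B : 'M[C]_(p, q)) i :
  (adjmx B *m T *m B) i i = (adjmx (col i B) *m T *m col i B) 0 0.
Proof.
have -> : adjmx (col i B) = row i (adjmx B) by apply/matrixP=> k l; rewrite !mxE.
by rewrite -row_mul !mxE; apply: eq_bigr => k _; rewrite !mxE.
Qed.

(** * Quadratic forms: congruence, sums and Hermitian symmetry *)

Lemma psd_congr p q (T : 'M[C]_p) (B : 'M[C]_(q, p)) :
  psd T -> psd (B *m T *m adjmx B).
Proof.
move=> hT v; have := hT (adjmx B *m v).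
by rewrite adjmxM adjmxK !mulmxA.
Qed.

Lemma pd_psd n (A : 'M[C]_n) : pd A -> psd A.
Proof.
move=> hA v; have [->|/hA/ltW//] := eqVneq v 0.
by rewrite mulmx0 mxE.
Qed.

Lemma pd1 n : pd (1%:M : 'M[C]_n).
Proof.
move=> v v0; rewrite mulmx1 mxE.
have [i vi] : exists i, v i 0 != 0.
  apply/existsP; rewrite -negb_forall; apply: contra v0 => /forallP h.
  by apply/eqP/colP=> i; rewrite (eqP (h i)) mxE.
rewrite (bigD1 i) //=; apply: ltr_wpDr.
  by apply: sumr_ge0 => k _; rewrite adjmxE mulrC mul_conjC_ge0.
by rewrite adjmxE mulrC mul_conjC_gt0.
Qed.

Lemma psd_mul_adj p q (B : 'M[C]_(p, q)) : psd (B *m adjmx B).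
Proof. by rewrite -[B in B *m _]mulmx1; apply/psd_congr/pd_psd/pd1. Qed.

Lemma psd_sum n (I : finType) (Q : pred I) (F : I -> 'M[C]_n) :
  (forall i, Q i -> psd (F i)) -> psd (\sum_(i | Q i) F i).
Proof.
move=> hF v; rewrite mulmx_sumr mulmx_suml summxE.
by apply: sumr_ge0 => i /hF; apply.
Qed.

(* Polarization along v + w and v + 'i w. *)
Lemma psd_hermitian n (A : 'M[C]_n) : psd A -> adjmx A = A.
Proof.
move=> hA; apply/matrixP=> i j; rewrite adjmxE.
pose h (v w : 'cV[C]_n) := (adjmx v *m A *m w) 0 0.
pose e k : 'cV[C]_n := delta_mx k 0.
have he k l : h (e k) (e l) = A k l.
  by rewrite /h /e adjmx_delta -rowE -colE !mxE.
have real v : (h v v)^* = h v v by apply/CrealP/ger0_real/hA.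
have expand a : h (e i + a *: e j) (e i + a *: e j)
    = A i i + a * A i j + (a^* * A j i + a^* * a * A j j).
  rewrite /h adjmxD adjmxZ !mulmxDl !mulmxDr -!scalemxAl -!scalemxAr.
  by rewrite -!he /h !mxE !mulrA; congr (_ + (_ + _)); rewrite !mxE.
have rk k : (A k k)^* = A k k by rewrite -he real.
have := real (e i + 1 *: e j); have := real (e i + 'i *: e j).
rewrite !expand !rmorphD !rmorphM /= !conjCK !rk conjCi conjC1 !mul1r.
set x := A i j; set y := A j i => h1 h2.
(* Reality at [e i + 'i *: e j] gives [y^* - x^* = x - y], and at [e i + e j] it gives
   [x^* + y^* = x + y]; subtracting yields [x^* = y]. *)
have e1 : 'i * ((y^* - x^*) - (x - y)) = 0 :> C.
  by move/eqP: h1; rewrite -subr_eq0 => /eqP h1; rewrite -[RHS]h1; ring.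
have e2 : x^* + y^* - (x + y) = 0.
  by move/eqP: h2; rewrite -subr_eq0 => /eqP h2; rewrite -[RHS]h2; ring.
move/eqP: e1; rewrite mulf_eq0 (negPf (neq0Ci _)) /= => /eqP e1.
have /eqP : (x^* - y) *+ 2 = 0.
  by rewrite -[RHS](subrr 0) -{1}e2 -e1; ring.
by rewrite mulrn_eq0 /= subr_eq0 => /eqP xy; rewrite -/y -xy conjCK.
Qed.

(** Diagonalise [A] by the spectral theorem and take roots of the eigenvalues. The root is a
    function of [A], so it inherits the commutant of [A]. *)
Lemma psd_sqrt n (A : 'M[C]_n) : psd A ->
  exists S : 'M[C]_n, [/\ adjmx S = S, S *m S = A
    & forall B, A *m B = B *m A -> S *m B = B *m S].
Proof.
move=> hA; have hAh := psd_hermitian hA.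
have [P [d [PP PP' dA]]] : exists (P : 'M[C]_n) (d : 'rV[C]_n), [/\ P *m adjmx P = 1%:M,
    adjmx P *m P = 1%:M & P *m A *m adjmx P = diag_mx d].
  have nA : A \is spectral.normalmx.
    by apply/spectral.normalmxP; rewrite -map_trmx -/(adjmx A) hAh.
  have eA := spectral.orthomx_spectralP nA.
  have uP := spectral.spectral_unitarymx A.
  have PP : spectralmx A *m adjmx (spectral.spectralmx A) = 1%:M.
    by rewrite /adjmx map_trmx; apply/spectral.unitarymxP.
  exists (spectral.spectralmx A), (spectral.spectral_diag A); split=> //; first exact: mulmx1C PP.
  rewrite {2}eA spectral.invmx_unitary // -map_trmx -/(adjmx _) !mulmxA PP mul1mx.
  by rewrite -mulmxA PP mulmx1.
have AE : A = adjmx P *m diag_mx d *m P.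
  by rewrite -dA !mulmxA PP' mul1mx -mulmxA PP' mulmx1.
have d_ge0 i : 0 <= d 0 i.
  have := psd_congr P hA; rewrite dA => /(_ (delta_mx i 0)).
  by rewrite adjmx_delta -rowE -colE !mxE eqxx mulr1n.
pose s : 'rV[C]_n := \row_i sqrtC (d 0 i).
have ss : diag_mx s *m diag_mx s = diag_mx d.
  rewrite mulmx_diag; congr diag_mx; apply/rowP=> i.
  by rewrite !mxE -expr2 sqrtCK.
exists (adjmx P *m diag_mx s *m P); split.
- rewrite !adjmxM adjmxK mulmxA; congr (_ *m _ *m _).
  apply/matrixP=> i j; rewrite adjmxE !mxE eq_sym; case: eqP => [->|_].
    by rewrite mulr1n; apply/CrealP/ger0_real; rewrite sqrtC_ge0.
  by rewrite !mulr0n conjC0.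
- rewrite !mulmxA -[_ *m P *m adjmx P]mulmxA PP mulmx1.
  by rewrite -[_ *m diag_mx s *m diag_mx s]mulmxA ss -AE.
move=> B AB; set B' := P *m B *m adjmx P.
have BE : B = adjmx P *m B' *m P.
  by rewrite /B' !mulmxA PP' mul1mx -mulmxA PP' mulmx1.
have dB : diag_mx d *m B' = B' *m diag_mx d.
  rewrite -dA /B' !mulmxA -[_ *m adjmx P *m P]mulmxA PP' mulmx1.
  by rewrite -[_ *m adjmx P *m P]mulmxA PP' mulmx1 -!mulmxA (mulmxA A) AB !mulmxA.
clearbody B'.
(* Commuting with [diag_mx d] forces [d_i = d_j] wherever [B' i j] is nonzero, and there the roots
   agree as well. *)
have sB : diag_mx s *m B' = B' *m diag_mx s.
  apply/matrixP=> i j; move/matrixP/(_ i j): dB.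
  rewrite !mul_diag_mx !mul_mx_diag !mxE => dBij.
  have [->|b0] := eqVneq (B' i j) 0; first by rewrite mulr0 mul0r.
  by move: dBij; rewrite [RHS]mulrC => /(mulIf b0) ->; rewrite mulrC.
rewrite BE !mulmxA -[_ *m P *m adjmx P]mulmxA PP mulmx1.
rewrite -[_ *m P *m adjmx P]mulmxA PP mulmx1.
by rewrite -[_ *m diag_mx s *m B']mulmxA sB mulmxA.
Qed.

(** * Trace pairing of positive matrices *)

Lemma psd_diag_ge0 n (A : 'M[C]_n) i : psd A -> 0 <= A i i.
Proof. by move=> /(_ (delta_mx i 0)); rewrite adjmx_delta -rowE -colE !mxE. Qed.

Lemma psd_tr_ge0 n (A : 'M[C]_n) : psd A -> 0 <= \tr A.
Proof. by move=> hA; apply: sumr_ge0 => i _; apply: psd_diag_ge0. Qed.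

Lemma psd_trM_ge0 n (A B : 'M[C]_n) : psd A -> psd B -> 0 <= \tr (A *m B).
Proof.
move=> /psd_sqrt[S [aS <- _]] hB.
rewrite mxtrace_mulC mulmxA mxtrace_mulC mulmxA -{2}aS.
exact/psd_tr_ge0/psd_congr.
Qed.

(** The trace sums the values of the form [B] on the columns of [S]; all are nonnegative, so all
    vanish, and definiteness kills every column. *)
Lemma pd_congr_tr_eq0 p q (B : 'M[C]_p) (S : 'M[C]_(p, q)) :
  pd B -> \tr (adjmx S *m B *m S) = 0 -> S = 0.
Proof.
move=> hB tr0; apply/matrixP=> i j; rewrite [RHS]mxE.
have hS : psd (adjmx S *m B *m S).
  by rewrite -{2}[S]adjmxK; apply/psd_congr/pd_psd.
have /eqP cS : col j S == 0.
  apply: contraT => /hB; rewrite -diag_adjmx_mul => /gt_eqF/eqP[].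
  by apply: psumr_eq0P tr0 j isT => k _; apply: psd_diag_ge0.
by move/colP: cS => /(_ i); rewrite !mxE.
Qed.

(** Faithfulness of a full-rank operator: with [A = S *m S], the trace is that of the congruence of
    [B] by [S]. This is how full rank enters part (b). *)
Lemma pd_trM_eq0 n (A B : 'M[C]_n) : psd A -> pd B -> \tr (A *m B) = 0 -> A = 0.
Proof.
move=> /psd_sqrt[S [aS <- _]] hB.
rewrite mxtrace_mulC mulmxA mxtrace_mulC mulmxA -{1}aS => /(pd_congr_tr_eq0 hB) ->.
exact: mulmx0.
Qed.

Lemma psd_tr_eq0 n (A : 'M[C]_n) : psd A -> \tr A = 0 -> A = 0.
Proof. by move=> hA tA; apply: (pd_trM_eq0 hA (@pd1 n)); rewrite mulmx1. Qed.

(** With [S] the square root of [A], the form at [v] is the squared norm of [S *m v]. *)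
Lemma psd_form_eq0 n (A : 'M[C]_n) (v : 'cV[C]_n) :
  psd A -> (adjmx v *m A *m v) 0 0 = 0 -> A *m v = 0.
Proof.
move=> /psd_sqrt[S [aS <- _]] e; rewrite -mulmxA.
suff -> : S *m v = 0 by rewrite mulmx0.
apply: contra_eq e => /pd1; rewrite mulmx1 adjmxM aS !mulmxA.
by move/gt_eqF->.
Qed.

Lemma psd_tens n m (A : 'M[C]_n) (B : 'M[C]_m) :
  psd A -> psd B -> psd (tensmx A B).
Proof.
move=> /psd_sqrt[S [aS <- _]] /psd_sqrt[R [aR <- _]].
by rewrite -tensmx_mul -{2}aS -{2}aR -adjmx_tens; apply: psd_mul_adj.
Qed.

(** * Tensor products and the partial trace *)

Lemma sum_mxtens_index (V : nmodType) m n (F : 'I_(m * n) -> V) :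
  \sum_k F k = \sum_i \sum_j F (mxtens_index (i, j)).
Proof.
rewrite pair_bigA; apply: reindex => /=; exists (@mxtens_unindex m n) => k _.
  by case: k => i j; apply: mxtens_indexK.
by case: (mxtens_indexP k) => i j; rewrite mxtens_indexK.
Qed.

Lemma mxtrace_tens n m (A : 'M[C]_n) (B : 'M[C]_m) :
  \tr (tensmx A B) = \tr A * \tr B.
Proof.
rewrite /mxtrace sum_mxtens_index mulr_suml; apply: eq_bigr => i _.
by rewrite mulr_sumr; apply: eq_bigr => j _; rewrite tensmxE.
Qed.

Lemma ptrace2_tens n m (A : 'M[C]_n) (B : 'M[C]_m) :
  ptrace2 (tensmx A B) = \tr B *: A.
Proof.
apply/matrixP=> i j; rewrite !mxE mulrC mulr_sumr.
by apply: eq_bigr => a _; rewrite tensmxE.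
Qed.

(** The partial trace is dual to tensoring with the identity; this moves every trace on the system
    to the composite space. *)
Lemma tr_mul_ptrace2 n m (A : 'M[C]_n) (M : 'M[C]_(n * m)) :
  \tr (A *m ptrace2 M) = \tr (tensmx A 1%:M *m M).
Proof.
rewrite /mxtrace sum_mxtens_index; apply: eq_bigr => i _.
rewrite mxE; under eq_bigr do rewrite mxE mulr_sumr.
rewrite exchange_big /=; apply: eq_bigr => a _.
rewrite mxE sum_mxtens_index; apply: eq_bigr => j _.
rewrite (bigD1 a) //= big1 ?addr0 => [|b ba].
  by rewrite tensmxE mxE eqxx mulr1.
by rewrite tensmxE mxE eq_sym (negPf ba) mulr0 mul0r.
Qed.

Lemma tensmxDl n m p q (A B : 'M[C]_(n, m)) (D : 'M[C]_(p, q)) :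
  tensmx (A + B) D = tensmx A D + tensmx B D.
Proof. by apply/matrixP=> i j; rewrite !mxE mulrDl. Qed.

Lemma tensmxDr n m p q (A : 'M[C]_(n, m)) (B D : 'M[C]_(p, q)) :
  tensmx A (B + D) = tensmx A B + tensmx A D.
Proof. by apply/matrixP=> i j; rewrite !mxE mulrDr. Qed.

Lemma tensmx11 n m : tensmx (1%:M : 'M[C]_n) (1%:M : 'M[C]_m) = 1%:M.
Proof.
apply/matrixP=> i j; case: (mxtens_indexP i) => a b; case: (mxtens_indexP j) => k l.
rewrite tensmxE !mxE (can_eq (@mxtens_indexK n m)) xpair_eqE.
by case: eqP; case: eqP; rewrite ?mulr1 ?mulr0.
Qed.

Lemma tensmx_suml n p (I : finType) (F : I -> 'M[C]_n) (B : 'M[C]_p) :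
  tensmx (\sum_i F i) B = \sum_i tensmx (F i) B.
Proof.
by apply: (big_morph (fun A => tensmx A B)) => [A A'|];
  rewrite ?tensmxDl ?tens0mx.
Qed.

Lemma tensmx_sumr n p (I : finType) (A : 'M[C]_n) (F : I -> 'M[C]_p) :
  tensmx A (\sum_i F i) = \sum_i tensmx A (F i).
Proof.
by apply: (big_morph (fun B => tensmx A B)) => [B B'|];
  rewrite ?tensmxDr ?tensmx0.
Qed.

Lemma sum_delta_diag p : \sum_(i < p) (delta_mx i i : 'M[C]_p) = 1%:M.
Proof.
apply/matrixP=> i j; rewrite summxE mxE (bigD1 i) //= big1 => [|k ki].
  by rewrite mxE eqxx addr0 eq_sym.
by rewrite mxE eq_sym (negPf ki).
Qed.

Lemma tensmx_eq0 m p (A : 'M[C]_m) (B : 'M[C]_p) : A != 0 -> tensmx A B = 0 -> B = 0.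
Proof.
move=> A0 AB; have /existsP[i /existsP[j Aij]] : [exists i, exists j, A i j != 0].
  apply: contraT; rewrite negb_exists => /forallP h.
  case/eqP: A0; apply/matrixP=> i j; rewrite mxE.
  by have := h i; rewrite negb_exists => /forallP/(_ j); rewrite negbK => /eqP.
apply/matrixP=> k l; rewrite mxE; apply: (mulfI Aij); rewrite mulr0.
by have /matrixP/(_ (mxtens_index (i, k)) (mxtens_index (j, l))) := AB; rewrite tensmxE mxE.
Qed.

Lemma pd_unitmx m (A : 'M[C]_m) : pd A -> A \in unitmx.
Proof.
move=> hA; rewrite -row_free_unit; apply: inj_row_free => v vA.
rewrite -[v]adjmxK; have [->|/hA] := eqVneq (adjmx v) 0.
  by apply/matrixP=> i j; rewrite !mxE conjC0.
by rewrite adjmxK vA mul0mx mxE ltxx.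
Qed.

(** The roots [S] and [R] are invertible, so [tensmx S R] is too, and the form at [v] is the squared
    norm of the nonzero vector [w]. *)
Lemma pd_tens m p (A : 'M[C]_m) (B : 'M[C]_p) : pd A -> pd B -> pd (tensmx A B).
Proof.
move=> hA hB; have [S [aS SA _]] := psd_sqrt (pd_psd hA).
have [R [aR RB _]] := psd_sqrt (pd_psd hB).
have : S \in unitmx by have := pd_unitmx hA; rewrite -SA unitmx_mul => /andP[].
have : R \in unitmx by have := pd_unitmx hB; rewrite -RB unitmx_mul => /andP[].
move=> uR uS v v0; pose w := tensmx S R *m v.
have -> : adjmx v *m tensmx A B *m v = adjmx w *m 1%:M *m w.
  by rewrite mulmx1 /w adjmxM adjmx_tens aS aR !mulmxA -[_ *m _ *m tensmx S R]mulmxA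
    tensmx_mul SA RB.
apply: pd1; apply: contra_neq v0 => w0.
by rewrite -[v]mul1mx -tensmx11 -(mulVmx uS) -(mulVmx uR) -tensmx_mul -mulmxA -/w w0 mulmx0.
Qed.

(** Both summands of the trace are nonnegative. It passes a vanishing trace from a positive operator
    to a smaller one. *)
Lemma psd_trMD_eq0 m (A B T : 'M[C]_m) : psd A -> psd B -> psd T ->
  \tr ((A + B) *m T) = 0 -> \tr (A *m T) = 0.
Proof.
move=> hA hB hT /eqP; rewrite mulmxDl raddfD /=.
by rewrite paddr_eq0 ?psd_trM_ge0 // => /andP[/eqP].
Qed.

(** * Spectrum, norm one and rank-one projections *)

Lemma unitmx_eigenvalue0 n (A : 'M[C]_n) : ~~ eigenvalue A 0 -> A \in unitmx.
Proof.
(* The eigenspace of 0 is the left kernel of [A]. *)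
rewrite negbK /eigenspace raddf0 subr0 => /eqP kA.
by rewrite -row_free_unit -kermx_eq0 kA.
Qed.

(** At a vector whose norm [A] preserves, the form of [1 - A] must vanish; as this operator is
    positive, it annihilates the vector. *)
Lemma opnorm1_fixed_vector n (A : 'M[C]_n) : psd A -> psd (1%:M - A) ->
  opnorm_eq1 A -> exists2 v : 'cV[C]_n, v != 0 & A *m v = v.
Proof.
move=> hA hA1 [_ [v [v0 normAv]]]; exists v => //.
have [S [aS SA _]] := psd_sqrt hA.
suff /(psd_form_eq0 hA1) : (adjmx v *m (1%:M - A) *m v) 0 0 = 0.
  by rewrite mulmxBl mul1mx => /eqP; rewrite subr_eq0 => /eqP.
(* 1 - A^2 = (1 - A) + S (1 - A) S, with both summands positive. *)
have e : (adjmx v *m (1%:M - A) *m v) 0 0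
    + (adjmx (S *m v) *m (1%:M - A) *m (S *m v)) 0 0 = 0.
  rewrite adjmxM aS; move/eqP: normAv; rewrite eq_sym -subr_eq0 adjmxM (psd_hermitian hA).
  move=> /eqP <-; rewrite -!SA !mulmxBr !mulmxBl !mulmx1 !mulmxA !mxE; ring.
apply/eqP; move/eqP: e; rewrite paddr_eq0; [by case/andP|exact: hA1|exact: hA1].
Qed.

Lemma mul_proj_cV n (A : 'M[C]_n) (v : 'cV[C]_n) a b :
  A *m v = b *: v -> A *m (a *: (v *m adjmx v)) = b *: (a *: (v *m adjmx v)).
Proof.
by move=> Av; rewrite -scalemxAr mulmxA Av -scalemxAl !scalerA mulrC.
Qed.

(** Dividing by the squared norm spares normalising [v]. Everything follows from [P *m v = v]. *)
Lemma unit_vector_proj n (v : 'cV[C]_n) (P := ((adjmx v *m v) 0 0)^-1 *: (v *m adjmx v)) :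
  v != 0 -> [/\ orth_proj P, psd P & P != 0].
Proof.
move=> v0; have vv : 0 < (adjmx v *m v) 0 0.
  by have := pd1 v0; rewrite mulmx1.
have vvE : adjmx v *m v = ((adjmx v *m v) 0 0)%:M by exact: mx11_scalar.
have aP : adjmx P = P.
  rewrite /P adjmxZ adjmxM adjmxK; congr (_ *: _).
  by apply/CrealP/ger0_real; rewrite invr_ge0 ltW.
have Pv : P *m v = v.
  rewrite /P -scalemxAl -mulmxA {2}vvE mul_mx_scalar scalerA mulVf ?scale1r //.
  by rewrite gt_eqF.
have PP : P *m P = P.
  by rewrite {2}/P -scalemxAr mulmxA Pv.
split=> //; first by rewrite -PP -{2}aP; apply: psd_mul_adj.
by apply: contra_neq v0 => P0; rewrite -Pv P0 mul0mx.
Qed.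

End Operators.

(** * Channels *)
Section Channels.
Variable C : numClosedFieldType.

(** * Linear maps and their duals *)

Lemma linmap0 n k (Phi : 'M[C]_n -> 'M[C]_k) : linmap Phi -> Phi 0 = 0.
Proof.
move=> L; have := L 1 0 0; rewrite !scale1r addr0 => /eqP.
by rewrite -subr_eq subrr eq_sym => /eqP.
Qed.

Lemma linmapZ n k (Phi : 'M[C]_n -> 'M[C]_k) a A :
  linmap Phi -> Phi (a *: A) = a *: Phi A.
Proof. by move=> L; have := L a A 0; rewrite (linmap0 L) !addr0. Qed.

Lemma linmapD n k (Phi : 'M[C]_n -> 'M[C]_k) A B :
  linmap Phi -> Phi (A + B) = Phi A + Phi B.
Proof. by move=> L; have := L 1 A B; rewrite !scale1r. Qed.

Lemma linmap_sum n k (Phi : 'M[C]_n -> 'M[C]_k) (I : finType) (F : I -> 'M[C]_n) :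
  linmap Phi -> Phi (\sum_i F i) = \sum_i Phi (F i).
Proof.
move=> L; apply: (big_morph Phi) => [A B|]; [exact: linmapD|exact: linmap0].
Qed.

Lemma sum_linmap n k (I : finType) (Phi : I -> 'M[C]_n -> 'M[C]_k) :
  (forall i, linmap (Phi i)) -> linmap (fun A => \sum_i Phi i A).
Proof.
move=> L a A B; rewrite scaler_sumr -big_split /=.
by apply: eq_bigr => i _; rewrite L.
Qed.

Lemma tr_dual n k (Phi : 'M[C]_n -> 'M[C]_k) A B :
  linmap Phi -> \tr (A *m Phi B) = \tr (dual Phi A *m B).
Proof.
move=> L; rewrite [in LHS](matrix_sum_delta B) (linmap_sum _ L) mulmx_sumr raddf_sum.
rewrite [RHS]mxtrace_mulC; apply: eq_bigr => i _.
rewrite (linmap_sum _ L) mulmx_sumr raddf_sum mxE; apply: eq_bigr => j _.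
by rewrite (linmapZ _ _ L) -scalemxAr /= mxtraceZ mxE.
Qed.

(** Complete positivity with a one-dimensional ancilla: [A] is lifted to [n * 1] by tensoring with a
    scalar identity, and the result is traced back. *)
Lemma CP_psd n k (Phi : 'M[C]_n -> 'M[C]_k) A : CP Phi -> psd A -> psd (Phi A).
Proof.
move=> [_ hCP] hA v.
pose X : 'M[C]_(n * 1) := tensmx A 1%:M.
have hX : psd X by apply: psd_tens => //; apply/pd_psd/pd1.
have -> : Phi A = ptrace2 (ampl Phi X).
  apply/matrixP=> i j; rewrite mxE big_ord1 mxE !mxtens_indexK /=; congr (Phi _ i j).
  by apply/matrixP=> p q; rewrite mxE /X tensmxE mxE eqxx mulr1.
(* The form at [v] becomes the trace of [v v^*] tensored with the identity against the amplified
   output. *)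
rewrite -trace_mx11 -mulmxA mxtrace_mulC -mulmxA mxtrace_mulC tr_mul_ptrace2.
apply: psd_trM_ge0; last exact: hCP.
apply: psd_tens; [exact: psd_mul_adj|exact/pd_psd/pd1].
Qed.

(** * Maps in Kraus form *)

Definition kraus n k (K : finType) (T : K -> 'M[C]_(k, n)) (A : 'M[C]_n) : 'M[C]_k :=
  \sum_i T i *m A *m adjmx (T i).

Lemma kraus_linmap n k (K : finType) (T : K -> 'M[C]_(k, n)) : linmap (kraus T).
Proof.
apply: sum_linmap => i a A B.
by rewrite mulmxDr mulmxDl -scalemxAr -scalemxAl.
Qed.

Lemma tens1_mulE n k r q (T : 'M[C]_(k, n)) (X : 'M[C]_(n * r, q)) a s j :
  (tensmx T (1%:M : 'M_r) *m X) (mxtens_index (a, s)) j =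
  \sum_i T a i * X (mxtens_index (i, s)) j.
Proof.
rewrite mxE sum_mxtens_index; apply: eq_bigr => i _.
rewrite (bigD1 s) //= big1 ?addr0 => [|t ts].
  by rewrite tensmxE mxE eqxx mulr1.
by rewrite tensmxE mxE eq_sym (negPf ts) mulr0 mul0r.
Qed.

Lemma mul_tens1E n k r q (T : 'M[C]_(n, k)) (X : 'M[C]_(q, n * r)) a s j :
  (X *m tensmx T (1%:M : 'M_r)) j (mxtens_index (a, s)) =
  \sum_i X j (mxtens_index (i, s)) * T i a.
Proof.
rewrite mxE sum_mxtens_index; apply: eq_bigr => i _.
rewrite (bigD1 s) //= big1 ?addr0 => [|t ts].
  by rewrite tensmxE mxE eqxx mulr1.
by rewrite tensmxE mxE (negPf ts) !mulr0.
Qed.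

Lemma ampl_kraus n k r (K : finType) (T : K -> 'M[C]_(k, n)) (X : 'M[C]_(n * r)) :
  ampl (kraus T) X = kraus (fun i => tensmx (T i) (1%:M : 'M_r)) X.
Proof.
apply/matrixP=> p q; case: (mxtens_indexP p) => a s.
case: (mxtens_indexP q) => b t; rewrite mxE !mxtens_indexK /= !summxE.
apply: eq_bigr => l _; rewrite adjmx_tens adjmx1 mul_tens1E mxE.
by apply: eq_bigr => j _; rewrite tens1_mulE mxE; congr (_ * _);
  apply: eq_bigr => i _; rewrite mxE.
Qed.

Lemma kraus_psd n k (K : finType) (T : K -> 'M[C]_(k, n)) A :
  psd A -> psd (kraus T A).
Proof. by move=> hA; apply: psd_sum => i _; apply: psd_congr. Qed.

(** Amplifying replaces each Kraus operator by its tensor product with the identity, so every level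
    reduces to positivity of a Kraus map. *)
Lemma kraus_CP n k (K : finType) (T : K -> 'M[C]_(k, n)) : CP (kraus T).
Proof.
split=> [|r X hX]; first exact: kraus_linmap.
by rewrite ampl_kraus; apply: kraus_psd.
Qed.

Lemma kraus_TP n k (K : finType) (T : K -> 'M[C]_(k, n)) :
  \sum_i adjmx (T i) *m T i = 1%:M -> TP (kraus T).
Proof.
move=> T1 A; rewrite raddf_sum -[in RHS](mul1mx A) -T1 mulmx_suml raddf_sum.
by apply: eq_bigr => i _; rewrite /= mxtrace_mulC mulmxA.
Qed.

(** The family [L] certifies that the adjoints of the [T i] have no common kernel vector, so some
    term of the form at [v] is strictly positive. *)
Lemma kraus_pd n k (K : finType) (T : K -> 'M[C]_(k, n)) (L : K -> 'M[C]_(k, n)) A :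
  \sum_i L i *m adjmx (T i) = 1%:M -> pd A -> pd (kraus T A).
Proof.
move=> LT hA v v0; rewrite mulmx_sumr mulmx_suml summxE.
have form i : (adjmx v *m (T i *m A *m adjmx (T i)) *m v) 0 0 =
    (adjmx (adjmx (T i) *m v) *m A *m (adjmx (T i) *m v)) 0 0.
  by rewrite adjmxM adjmxK !mulmxA.
have [i Ti] : exists i, adjmx (T i) *m v != 0.
  apply/existsP; rewrite -negb_forall; apply: contra v0 => /forallP h.
  rewrite -(mul1mx v) -LT mulmx_suml big1 // => i _.
  by rewrite -mulmxA (eqP (h i)) mulmx0.
rewrite (bigD1 i) //=; apply: ltr_wpDr; last by rewrite form; apply: hA.
by apply: sumr_ge0 => j _; rewrite form; apply: pd_psd.
Qed.

Lemma dual_kraus n k (K : finType) (T : K -> 'M[C]_(k, n)) A :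
  dual (kraus T) A = \sum_i adjmx (T i) *m A *m T i.
Proof.
apply/matrixP=> i j; rewrite mxE -mxtrace_mul_delta mulmx_sumr raddf_sum.
rewrite mulmx_suml raddf_sum; apply: eq_bigr => l _ /=.
by rewrite !mulmxA mxtrace_mulC !mulmxA.
Qed.

(** Rescale to a state when the trace is nonzero; a positive matrix of zero trace is zero. *)
Lemma tr_eq_on_psd n (Phi : 'M[C]_n -> 'M[C]_n) (A B : 'M[C]_n) :
  linmap Phi -> (forall rho, is_state rho -> \tr (Phi rho) = \tr (A *m rho)) ->
  psd B -> \tr (Phi B) = \tr (A *m B).
Proof.
move=> L h hB; have [tB|tB] := eqVneq (\tr B) 0.
  by rewrite (psd_tr_eq0 hB tB) (linmap0 L) mulmx0.
have BE : B = \tr B *: ((\tr B)^-1 *: B) by rewrite scalerA mulfV // scale1r.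
rewrite BE (linmapZ _ _ L) -scalemxAr !mxtraceZ h //.
split; last by rewrite mxtraceZ mulVf.
move=> v; rewrite -scalemxAr -scalemxAl mxE mulr_ge0 //.
by rewrite invr_ge0; apply: psd_tr_ge0.
Qed.

Lemma third_law_pd m p (Phi : 'M[C]_m -> 'M[C]_p) (T : 'M[C]_m) :
  (0 < m)%N -> linmap Phi -> third_law Phi -> pd T -> pd (Phi T).
Proof.
move=> m0 L h3 hT.
have tT : 0 < \tr T.
  rewrite lt_neqAle eq_sym psd_tr_ge0 ?andbT; last exact: pd_psd.
  (* Zero trace would make [T] zero, against definiteness at a basis vector, which exists since [m]
     is positive. *)
  apply/eqP => t0.
  have := hT (delta_mx (Ordinal m0) 0).
  rewrite (psd_tr_eq0 (pd_psd hT) t0) mulmx0 mul0mx mxE ltxx.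
  suff n0 : delta_mx (Ordinal m0) 0 != 0 :> 'cV[C]_m by move/(_ n0).
  by apply/eqP=> /matrixP/(_ (Ordinal m0) 0)/eqP; rewrite !mxE !eqxx oner_eq0.
have st : full_rank_state ((\tr T)^-1 *: T).
  split=> [v v0|]; last by rewrite mxtraceZ mulVf // gt_eqF.
  by rewrite -scalemxAr -scalemxAl mxE mulr_gt0 ?invr_gt0 // hT.
have [hP _] := h3 _ st => v v0.
have -> : Phi T = \tr T *: Phi ((\tr T)^-1 *: T).
  by rewrite -(linmapZ _ _ L) scalerA mulfV ?scale1r // gt_eqF.
by rewrite -scalemxAr -scalemxAl mxE mulr_gt0 // hP.
Qed.

End Channels.

(** * Instruments *)
Lemma sum_neq (X : finType) (V : zmodType) (F : X -> V) x :
  \sum_(y | y != x) F y = \sum_y F y - F x.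
Proof. by rewrite [in RHS](bigD1 x) //= addrAC subrr add0r. Qed.

Section Instruments.
Variables (C : numClosedFieldType) (n : nat) (X : finType).

(* The trace of [\sum_x [S x, A]^* [S x, A]] vanishes when [A] is fixed. *)
Lemma lueders_fixed (S : X -> 'M[C]_n) (A : 'M[C]_n) :
  (forall x, adjmx (S x) = S x) -> \sum_x S x *m S x = 1%:M ->
  \sum_x S x *m A *m S x = A -> forall x, S x *m A = A *m S x.
Proof.
move=> aS S1 fixA x.
pose D y := S y *m A - A *m S y.
have aD y : adjmx (D y) = adjmx A *m S y - S y *m adjmx A.
  by rewrite /D -scaleN1r adjmxD adjmxZ !adjmxM aS rmorphN1 scaleN1r.
have trD y : \tr (adjmx (D y) *m D y) =
    \tr (adjmx A *m (S y *m S y) *m A) - \tr (adjmx A *m (S y *m A *m S y)) *+ 2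
    + \tr (adjmx A *m A *m (S y *m S y)).
  rewrite aD /D mulmxBl !mulmxBr !linearB /= !mulmxA.
  have -> : \tr (S y *m adjmx A *m S y *m A) = \tr (adjmx A *m S y *m A *m S y).
    by rewrite [RHS]mxtrace_mulC !mulmxA.
  have -> : \tr (S y *m adjmx A *m A *m S y) = \tr (adjmx A *m A *m S y *m S y).
    by rewrite [RHS]mxtrace_mulC !mulmxA.
  by ring.
have psdD y : psd (adjmx (D y) *m D y).
  by rewrite -{2}[D y]adjmxK; apply: psd_mul_adj.
(* By [S1] and [fixA], the three sums are [t], [2t] and [t] for [t] the trace of [adjmx A *m A],
   with signs plus, minus, plus. *)
have sumD : \sum_y \tr (adjmx (D y) *m D y) = 0.
  under eq_bigr do rewrite trD.
  rewrite big_split sumrB sumrMnl -!raddf_sum /=.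
  rewrite -mulmx_suml -!mulmx_sumr S1 fixA !mulmx1; ring.
have /eqP : \tr (adjmx (D x) *m D x) = 0.
  apply: psumr_eq0P sumD x isT => y _; exact: psd_tr_ge0.
rewrite -[adjmx _]mulmx1 => /eqP/(pd_congr_tr_eq0 (@pd1 C n))/eqP.
by rewrite subr_eq0 => /eqP.
Qed.

(** * The Lueders instrument and its measurement scheme *)

Section Lueders.
Variables (S : X -> 'M[C]_n) (E : X -> 'M[C]_n).
Hypotheses (aS : forall x, adjmx (S x) = S x) (SE : forall x, S x *m S x = E x).
Hypothesis E1 : \sum_x E x = 1%:M.

Definition lueders x (rho : 'M[C]_n) := S x *m rho *m S x.

Lemma lueders_kraus x : lueders x =1 kraus (fun _ : 'I_1 => S x).
Proof. by move=> rho; rewrite /kraus big_ord1 aS. Qed.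

Lemma lueders_instrument : instrument E lueders.
Proof.
split=> [x|x rho _]; last by rewrite mxtrace_mulC mulmxA SE.
have [L P] := @kraus_CP C n n _ (fun _ : 'I_1 => S x).
split=> [a A B|r Y hY]; first by rewrite !lueders_kraus L.
suff -> : ampl (lueders x) Y = ampl (kraus (fun _ : 'I_1 => S x)) Y by apply: P.
by apply/matrixP=> i j; rewrite mxE lueders_kraus [RHS]mxE.
Qed.

Lemma lueders_total : instr_total lueders =1 kraus S.
Proof. by move=> rho; apply: eq_bigr => x _; rewrite aS. Qed.

Lemma dual_lueders A : dual (instr_total lueders) A = \sum_x S x *m A *m S x.
Proof.
transitivity (dual (kraus S) A); last by rewrite dual_kraus; under eq_bigr do rewrite aS.
by apply/matrixP=> i j; rewrite mxE lueders_total [RHS]mxE.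
Qed.

Let m := #|X|.

Definition pointer (x : X) : 'M[C]_m := delta_mx (enum_rank x) (enum_rank x).

(** The operator [S_x] tensored with [|x><a|]: summing over [a] discards the old pointer state, and
    [|x>] records the outcome. *)
Definition lueders_scheme_kraus (k : X * 'I_m) : 'M[C]_(n * m) :=
  tensmx (S k.1) (delta_mx (enum_rank k.1) k.2).

Lemma sum_pointer : \sum_x pointer x = 1%:M.
Proof.
rewrite -sum_delta_diag; symmetry; apply: (reindex enum_rank).
exact/onW_bij/enum_rank_bij.
Qed.

Lemma lueders_third_law_implementable :
  (0 < n)%N -> (forall x, S x \in unitmx) -> third_law_implementable lueders.
Proof.
move=> n0 uS.
have m0 : (0 < m)%N.
  apply/card_gt0P; case: (pickP X) => [x _|X0]; first by exists x.
  move: E1; rewrite big_pred0 // => /matrixP/(_ (Ordinal n0) (Ordinal n0)).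
  by rewrite !mxE eqxx => /esym/eqP; rewrite oner_eq0.
have mC0 : m%:R != 0 :> C by rewrite pnatr_eq0 -lt0n.
have SS k : adjmx (lueders_scheme_kraus k) =
    tensmx (S k.1) (delta_mx k.2 (enum_rank k.1)).
  by rewrite adjmx_tens aS adjmx_delta.
have pd_xi : pd ((m%:R)^-1%:M : 'M[C]_m).
  move=> v v0; rewrite -scalemx1 -scalemxAr -scalemxAl mxE.
  by rewrite mulr_gt0 ?invr_gt0 ?ltr0n ?pd1.
have psd_pointer x : psd (pointer x).
  by rewrite /pointer -(mul_delta_mx (enum_rank x)) -{2}adjmx_delta; apply: psd_mul_adj.
have TPT : TP (kraus lueders_scheme_kraus).
  apply: kraus_TP.
  transitivity (\sum_x \sum_a tensmx (E x) (delta_mx a a : 'M[C]_m)).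
    rewrite pair_bigA; apply: eq_bigr => k _.
    by rewrite SS tensmx_mul SE mul_delta_mx.
  under eq_bigr do rewrite -tensmx_sumr sum_delta_diag.
  by rewrite -tensmx_suml E1 tensmx11.
exists m, ((m%:R)^-1%:M), (kraus lueders_scheme_kraus), pointer.
do !split=> //.
- exact: pd_psd.
- by rewrite mxtrace_scalar -[_ *+ m]mulr_natr mulVf.
- exact: kraus_linmap.
- by case: (kraus_CP lueders_scheme_kraus).
- exact: sum_pointer.
- case: H => hrho _.
  (* Each product of [L k] with the adjoint Kraus operator is the identity tensored with
     [|x><x| / m]; the factor [1 / m] compensates for the [m] values of [a]. *)
  apply: (kraus_pd (L := fun k => tensmx (invmx (S k.1))
     ((m%:R)^-1 *: delta_mx (enum_rank k.1) k.2))) hrho.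
  transitivity (\sum_x \sum_(a < m) tensmx (1%:M : 'M[C]_n) ((m%:R)^-1 *: pointer x)).
    rewrite pair_bigA; apply: eq_bigr => k _.
    by rewrite SS tensmx_mul mulVmx // -scalemxAl mul_delta_mx.
  under eq_bigr do rewrite -tensmx_sumr sumr_const card_ord -scaler_nat scalerA mulfV // scale1r.
  by rewrite -tensmx_sumr sum_pointer tensmx11.
- by rewrite TPT; case: H.
move=> x rho; rewrite /kraus mulmx_sumr.
transitivity (ptrace2 (tensmx (S x *m rho *m S x) (pointer x))).
  by rewrite ptrace2_tens -[pointer x]mul1mx mxtrace_mul_delta mxE eqxx scale1r.
congr ptrace2.
(* The effect [pointer x] keeps only the terms with [y = x], and each [a] contributes the weight
   [<a|xi|a> = 1 / m]. *)
transitivity (\sum_y \sum_(a < m) (if y == x then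
    tensmx (S x *m rho *m S x) ((m%:R)^-1 *: pointer x) else 0)).
  rewrite (bigD1 x) //= eqxx [X in _ + X]big1 ?addr0 => [|y /negPf ->]; last exact: big1.
  by rewrite -tensmx_sumr sumr_const card_ord -scaler_nat scalerA mulfV // scale1r.
rewrite pair_bigA; apply: eq_bigr => -[y a] _ /=.
rewrite SS /lueders_scheme_kraus !tensmx_mul mul1mx /pointer /=.
rewrite mul_mx_scalar -scalemxAl mul_delta_mx -scalemxAr mul_delta_mx_cond.
rewrite (inj_eq enum_rank_inj) eq_sym; case: eqP => [->|_] //.
by rewrite mulr0n scaler0 tensmx0.
Qed.
End Lueders.

Lemma observable_sqrt (E : X -> 'M[C]_n) : observable E ->
  exists S : X -> 'M[C]_n, [/\ forall x, adjmx (S x) = S x,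
    forall x, S x *m S x = E x
    & forall x B, E x *m B = B *m E x -> S x *m B = B *m S x].
Proof.
move=> [_ [hE _]].
have /fin_all_exists[S hS] x := psd_sqrt (hE x).
by exists S; split=> x; case: (hS x).
Qed.

Lemma tr_dual_total (I : X -> 'M[C]_n -> 'M[C]_n) A rho :
  (forall x, CP (I x)) ->
  \tr (A *m instr_total I rho) = \tr (dual (instr_total I) A *m rho).
Proof. by move=> hI; apply/tr_dual/sum_linmap => x; case: (hI x). Qed.

(** Excluding 0 from the spectra makes the roots [S x] invertible, as the scheme requires. Fixed
    points are the matrices commuting with all roots, equivalently with their squares [E x]. *)
Lemma unsharp_instrument (E : X -> 'M[C]_n) :
  (0 < n)%N -> observable E -> completely_unsharp E ->
  exists I : X -> 'M[C]_n -> 'M[C]_n,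
    [/\ instrument E I, third_law_implementable I
      & forall A, dual (instr_total I) A = A <-> commutes_with E A].
Proof.
move=> n0 obsE unsharp; have [S [aS SE commS]] := observable_sqrt obsE.
have [_ [_ [_ E1]]] := obsE.
have S1 : \sum_x S x *m S x = 1%:M by under eq_bigr do rewrite SE.
exists (lueders S); split=> [||A].
- exact: lueders_instrument.
- apply: (lueders_third_law_implementable aS SE) => // x.
  have /unitmx_eigenvalue0 := (unsharp x).1.
  by rewrite -SE unitmx_mul => /andP[].
rewrite dual_lueders //; split=> [fixA x|commA].
  have SA := lueders_fixed aS S1 fixA x.
  by rewrite -SE mulmxA -SA -!mulmxA SA.
rewrite -[RHS](mulmx1 A) -S1 mulmx_sumr; apply: eq_bigr => x _.
by rewrite commS ?mulmxA // commA.
Qed.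

(** * The obstruction for effects of norm one *)

Lemma observable_fixed_vector_kernel (E : X -> 'M[C]_n) x (v : 'cV[C]_n) :
  observable E -> E x *m v = v -> forall y, y != x -> E y *m v = 0.
Proof.
move=> [_ [hE [_ E1]]] Ev y yx; apply: (psd_form_eq0 (hE y)).
(* The sum is the form of [1 - E x] at [v], which vanishes, and its terms are nonnegative. *)
have : \sum_(z | z != x) (adjmx v *m E z *m v) 0 0 = 0.
  rewrite -summxE -mulmx_suml -mulmx_sumr sum_neq E1.
  by rewrite mulmxBr mulmxBl mulmx1 -[_ *m E x *m v]mulmxA Ev subrr mxE.
by move/psumr_eq0P; apply=> // z _; apply: hE.
Qed.

Lemma observable_eq1 (E : X -> 'M[C]_n) x :
  observable E -> E x = 1%:M -> forall y, exists c : C, E y = c%:M.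
Proof.
move=> [_ [hE [_ E1]]] Ex y; have [->|yx] := eqVneq y x; first by exists 1.
exists 0; rewrite raddf0; apply: psd_tr_eq0 => //.
have : \sum_(z | z != x) \tr (E z) = 0.
  by rewrite -raddf_sum sum_neq E1 Ex subrr raddf0.
by move/psumr_eq0P; apply=> // z _; apply: psd_tr_ge0.
Qed.

Lemma third_law_disturbs (E : X -> 'M[C]_n) (P : 'M[C]_n)
    (I : X -> 'M[C]_n -> 'M[C]_n) x :
  (0 < n)%N -> observable E -> orth_proj P -> P != 0 -> E x *m P = P ->
  instrument E I -> third_law_implementable I ->
  dual (instr_total I) P = P -> E x = 1%:M.
Proof.
move=> n0 [_ [hE [hE1 _]]] [PP aP] P0 EP [cpI trI] thirdI fixP.
have [m [xi [Phi [Z [[[_ trxi] [[cpPhi tpPhi] [hZ Z1]]] [pdxi [h3 impl]]]]]]] := thirdI.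
pose Q := 1%:M - P.
have aQ : adjmx Q = Q by rewrite /Q -scaleN1r adjmxD adjmxZ adjmx1 aP rmorphN1.
have QQ : Q *m Q = Q by rewrite /Q mulmxBl mul1mx mulmxBr mulmx1 PP subrr subr0.
have psdP : psd P by rewrite -PP -{2}aP; apply: psd_mul_adj.
have psdQ : psd Q by rewrite -QQ -{2}aQ; apply: psd_mul_adj.
have psdxi := pd_psd pdxi.
have trIx y A : psd A -> \tr (I y A) = \tr (E y *m A).
  by apply: tr_eq_on_psd; [case: (cpI y) | exact: trI].
have psdZ1 : psd (1%:M - Z x).
  by rewrite -Z1 -sum_neq; apply: psd_sum => y _.
have psd1 p : psd (1%:M : 'M[C]_p) by apply/pd_psd/pd1.
pose T A := Phi (tensmx A xi).
have psdT A : psd A -> psd (T A).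
  by move=> hA; apply: (CP_psd cpPhi); apply: psd_tens.
have trT A : \tr (T A) = \tr A by rewrite tpPhi mxtrace_tens trxi mulr1.
(* The weight with which the outcome differs from [x] on input [A]. *)
have Zdef A : psd A ->
    \tr (tensmx 1%:M (1%:M - Z x) *m T A) = \tr A - \tr (E x *m A).
  move=> hA; rewrite -trIx // impl -[in RHS](mul1mx (ptrace2 _)) tr_mul_ptrace2.
  rewrite mulmxA tensmx_mul !mul1mx; apply/eqP; rewrite eq_sym subr_eq.
  by rewrite -raddfD /= -mulmxDl -tensmxDr subrK tensmx11 mul1mx trT.
(* Summing over the outcomes turns this into the trace of [P] against the total channel at [Q]; by
   duality and [fixP] it is the trace of [P *m Q = 0]. *)
have trQ : \tr (tensmx P 1%:M *m T Q) = 0.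
  transitivity (\tr (P *m instr_total I Q)); last first.
    by rewrite tr_dual_total // fixP /Q mulmxBr mulmx1 PP subrr raddf0.
  rewrite -Z1 tensmx_sumr mulmx_suml mulmx_sumr !raddf_sum /=.
  apply: eq_bigr => y _.
  by rewrite impl tr_mul_ptrace2 mulmxA tensmx_mul mulmx1 mul1mx.
have trP : \tr (tensmx 1%:M (1%:M - Z x) *m T P) = 0 by rewrite Zdef // EP subrr.
have psdPZ : psd (tensmx P (1%:M - Z x)) by apply: psd_tens.
(* [P (x) (1 - Z_x)] lies below [1 (x) (1 - Z_x)], with remainder [Q (x) (1 - Z_x)], and below
   [P (x) 1], with remainder [P (x) Z_x]. The first bound handles [T P], the second [T Q]. *)
have trPZ : \tr (tensmx P (1%:M - Z x) *m T 1%:M) = 0.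
  have -> : T 1%:M = T P + T Q.
    by rewrite -(linmapD _ _ cpPhi.1) -tensmxDl addrC subrK.
  rewrite mulmxDr raddfD /=.
  have -> : \tr (tensmx P (1%:M - Z x) *m T P) = 0.
    apply: (psd_trMD_eq0 psdPZ (psd_tens psdQ psdZ1) (psdT _ psdP)).
    by rewrite -tensmxDl addrC subrK trP.
  have -> : \tr (tensmx P (1%:M - Z x) *m T Q) = 0.
    apply: (psd_trMD_eq0 psdPZ (psd_tens psdP (hZ x)) (psdT _ psdQ)).
    by rewrite -tensmxDr subrK trQ.
  exact: addr0.
have m0 : (0 < m)%N.
  rewrite lt0n; apply: contra_eqN trxi => /eqP m0.
  rewrite /mxtrace big1 => [|i _]; first by rewrite eq_sym oner_eq0.
  by have := ltn_ord i; rewrite [in X in (_ < X)%N]m0.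
have pdT1 : pd (T 1%:M).
  apply: (third_law_pd _ cpPhi.1 h3); first by rewrite muln_gt0 n0.
  by apply: pd_tens => //; apply: pd1.
have /(tensmx_eq0 P0) /eqP := pd_trM_eq0 psdPZ pdT1 trPZ.
rewrite subr_eq0 => /eqP Zx1.
(* With [Z x = 1] the outcome [x] is certain on every input, so [1 - E x] has trace zero. *)
have := Zdef 1%:M (psd1 n); rewrite -Zx1 subrr tensmx0 mul0mx raddf0 mulmx1.
rewrite -raddfB => /esym /(psd_tr_eq0 (hE1 x)) /eqP.
by rewrite subr_eq0 => /eqP.
Qed.

End Instruments.

Theorem theorem1 (C : numClosedFieldType) (n : nat) (Hn : (2 <= n)%N)
  (X : finType) (E : X -> 'M[C]_n)
  (HE : observable E) (Hnt : nontrivial E) :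
  (completely_unsharp E ->
     exists I : X -> 'M[C]_n -> 'M[C]_n,
       instrument E I /\ third_law_implementable I /\
       (forall (Y : finType) (F : Y -> 'M[C]_n),
          observable F -> (forall y, commutes_with E (F y)) ->
          does_not_disturb I F) /\
       (forall A : 'M[C]_n,
          dual (instr_total I) A = A <-> commutes_with E A)) /\
  ((exists x, opnorm_eq1 (E x)) ->
     exists P : 'M[C]_n,
       orth_proj P /\ commutes_with E P /\
       (forall I : X -> 'M[C]_n -> 'M[C]_n,
          instrument E I -> third_law_implementable I ->
          dual (instr_total I) P <> P)).
Proof.
have n0 : (0 < n)%N := ltnW Hn.
split=> [unsharp|[x normEx]].
  have [I [instI thirdI fixI]] := unsharp_instrument n0 HE unsharp.
  exists I; do !split=> //; try exact: (fixI _).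
  move=> Y F _ commF y rho _; rewrite tr_dual_total; last by case: instI.
  by have /fixI -> := commF y.
have [_ [hE [hE1 _]]] := HE.
have [v v0 Ev] := opnorm1_fixed_vector (hE x) (hE1 x) normEx.
have [projP psdP P0] := unit_vector_proj v0.
set P := _ *: _ in projP psdP P0.
have EP y : E y *m P = (y == x)%:R *: P.
  apply: mul_proj_cV; have [->|yx] := eqVneq y x; first by rewrite scale1r.
  by rewrite scale0r (observable_fixed_vector_kernel HE Ev).
have aP := psd_hermitian psdP.
exists P; split=> //; split=> [y|I instI thirdI fixP].
  (* The adjoint of [EP y] gives the same value for [P *m E y], since the coefficient is 0 or 1. *)
  have := congr1 (@adjmx C n n) (EP y).
  by rewrite adjmxM aP (psd_hermitian (hE y)) adjmxZ aP conjC_nat EP.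
have EPx : E x *m P = P by rewrite EP eqxx scale1r.
have Ex1 := third_law_disturbs n0 HE projP P0 EPx instI thirdI fixP.
by case: Hnt => y; apply; apply: observable_eq1 HE Ex1 y.
Qed.
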